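(* Let $M=[m_{ij}]\in\mathbb{R}^{n\times n}$ be a $B$-matrix, and write $M=B^++C$, where $B^+=[b_{ij}]\in\mathbb{R}^{n\times n}$ has entries $b_{ij}=m_{ij}-r_i^+$ with $r_i^+=\max\{0,\ m_{ij}\mid j\neq i\}$. For $k=1,\dots,n$ let $$l_k(B^+)=\max_{k\le i\le n}\left\{\frac{1}{|b_{ii}|}\sum_{j=k,\ j\neq i}^{n}|b_{ij}|\right\},$$ and for $i=1,\dots,n$ let $$\bar\beta_i=b_{ii}-\sum_{j=i+1}^{n}|b_{ij}|\,l_i(B^+),\qquad \tilde\beta_i=b_{ii}-\sum_{j=i+1}^{n}|b_{ij}|.$$ Then $$\sum_{i=1}^{n}\frac{n-1}{\min\{\bar\beta_i,1\}}\prod_{j=1}^{i-1}\frac{b_{jj}}{\bar\beta_j}\ \le\ \sum_{i=1}^{n}\frac{n-1}{\min\{\bar\beta_i,1\}}\prod_{j=1}^{i-1}\left(1+\frac{1}{\bar\beta_j}\sum_{k=j+1}^{n}|b_{jk}|\right)\ \le\ \sum_{i=1}^{n}\left(\frac{n-1}{\min\{\tilde\beta_i,1\}}\prod_{j=1}^{i-1}\frac{b_{jj}}{\tilde\beta_j}\right),$$ where each product $\prod_{j=1}^{i-1}$ is $1$ if $i=1$.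
   Context: A real matrix $M=[m_{ij}]\in\mathbb{R}^{n\times n}$ is called a $B$-matrix if for each $i\in\{1,\dots,n\}$, $$\sum_{k=1}^n m_{ik}>0\quad\text{and}\quad \frac1n\left(\sum_{k=1}^n m_{ik}\right)>m_{ij}\ \text{ for every } j\in\{1,\dots,n\},\ j\neq i.$$ Empty sums are $0$. *)

(* Defs.v *)
(* Indices 1..n are shifted to 0..n-1; only their order matters below. *)
From HB Require Import structures.
From mathcomp Require Import all_boot all_order all_algebra.
From mathcomp Require Import reals.

Set Implicit Arguments.
Unset Strict Implicit.
Unset Printing Implicit Defensive.

Import Order.TTheory GRing.Theory Num.Theory.
Local Open Scope ring_scope.

Definition B_matrix (R : realType) (n : nat) (M : 'M[R]_n) : Prop :=
  forall i : 'I_n,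
    0 < \sum_(k < n) M i k /\
    (forall j : 'I_n, j != i -> M i j < n%:R^-1 * \sum_(k < n) M i k).

Definition rplus (R : realType) (n : nat) (M : 'M[R]_n) (i : 'I_n) : R :=
  \big[Num.max/0]_(j < n | j != i) M i j.

Definition Bplus (R : realType) (n : nat) (M : 'M[R]_n) : 'M[R]_n :=
  \matrix_(i < n, j < n) (M i j - rplus M i).

(* The default value 0 of the maximum is harmless: the range contains i = k
   and every term is nonnegative. *)
Definition lmax (R : realType) (n : nat) (B : 'M[R]_n) (k : 'I_n) : R :=
  \big[Num.max/0]_(i < n | (k <= i)%N)
    (`|B i i|^-1 * \sum_(j < n | (k <= j)%N && (j != i)) `|B i j|).

Definition beta_bar (R : realType) (n : nat) (B : 'M[R]_n) (i : 'I_n) : R :=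
  B i i - \sum_(j < n | (i < j)%N) `|B i j| * lmax B i.

Definition beta_tilde (R : realType) (n : nat) (B : 'M[R]_n) (i : 'I_n) : R :=
  B i i - \sum_(j < n | (i < j)%N) `|B i j|.

(* Main.v *)
(* B+ is strictly diagonally dominant with positive diagonal, so l_i <= 1 and
   0 < beta_tilde_i <= beta_bar_i. With S_i the sum of |b_ij| over j > i, the
   factors then compare termwise:
     b_ii / beta_bar_i = 1 + S_i l_i / beta_bar_i <= 1 + S_i / beta_bar_i
       <= 1 + S_i / beta_tilde_i = b_ii / beta_tilde_i. *)
Require Import Defs.
From HB Require Import structures.
From mathcomp Require Import all_boot all_order all_algebra.
From mathcomp Require Import reals.

Set Implicit Arguments.
Unset Strict Implicit.
Unset Printing Implicit Defensive.

Import Order.TTheory GRing.Theory Num.Theory.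
Local Open Scope ring_scope.

Section PositiveDiagonallyDominant.

Variables (R : realType) (n : nat).
Implicit Types (M B : 'M[R]_n) (i j k : 'I_n).

(** The right side is the signed entry, not its absolute value, so positivity of the diagonal is
    built in. *)
Definition pos_diag_dominant B : Prop :=
  forall i, \sum_(j < n | j != i) `|B i j| < B i i.

Lemma le_rplus M i j : j != i -> M i j <= rplus M i.
Proof. by move=> ji; exact: le_bigmax_cond. Qed.

Lemma Bplus_row_sum M i :
  \sum_(j < n) Bplus M i j = \sum_(j < n) M i j - n%:R * rplus M i.
Proof.
under eq_bigr => j _ do rewrite mxE.
by rewrite sumrB sumr_const card_ord mulr_natl.
Qed.

(** After division by n, the claim is that the mean of row [i] of [M] exceeds [rplus M i].
    Positivity of the row sum handles the 0 in that maximum, and the second clause of [B_matrix]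
    handles the off-diagonal entries. *)
Lemma B_matrix_Bplus_row_sum_gt0 M i :
  B_matrix M -> 0 < \sum_(j < n) Bplus M i j.
Proof.
move=> /(_ i)[sum_gt0 mean_gt].
have n_gt0 : 0 < n%:R :> R by rewrite ltr0n (leq_ltn_trans _ (ltn_ord i)).
rewrite Bplus_row_sum subr_gt0 -ltr_pdivlMl // /rplus.
by apply: bigmax_lt => //; rewrite mulr_gt0 ?invr_gt0.
Qed.

(* The off-diagonal entries of B+ are nonpositive, so its row sums are exactly
   the diagonal dominance gaps. *)
Lemma B_matrix_Bplus_dominant M : B_matrix M -> pos_diag_dominant (Bplus M).
Proof.
move=> /B_matrix_Bplus_row_sum_gt0 row_gt0 i.
rewrite -subr_gt0 -sumrN; have := row_gt0 i.
rewrite (bigD1 i) //=; congr (0 < _ + _); apply: eq_bigr => j ji.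
by rewrite ler0_norm ?opprK // mxE subr_le0 le_rplus.
Qed.

Variable B : 'M[R]_n.
Hypothesis domB : pos_diag_dominant B.

Lemma dominant_diag_gt0 i : 0 < B i i.
Proof. exact: le_lt_trans (sumr_ge0 _ _) (domB i). Qed.

(** Brings the partial row sums in [lmax] ([k <= j]) and [beta_tilde] ([i < j]) under the dominance
    bound. *)
Lemma sum_offdiag_le (P : pred 'I_n) i :
  \sum_(j < n | P j && (j != i)) `|B i j| <= \sum_(j < n | j != i) `|B i j|.
Proof.
rewrite [leRHS](bigID P) /= (eq_bigl _ _ (fun j => andbC _ _)).
by rewrite lerDl sumr_ge0.
Qed.

Lemma lmax_le1 k : lmax B k <= 1.
Proof.
apply: bigmax_le => // i _; have Bii_gt0 := dominant_diag_gt0 i.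
rewrite gtr0_norm // ler_pdivrMl // mulr1.
exact: le_trans (sum_offdiag_le _ _) (ltW (domB i)).
Qed.

Lemma beta_tilde_gt0 i : 0 < beta_tilde B i.
Proof.
rewrite subr_gt0; apply: le_lt_trans (domB i).
apply: le_trans (sum_offdiag_le (fun j => (i < j)%N) i).
(* The two sums are equal, since [i < j] already forces [j != i]. *)
rewrite le_eqVlt; apply/orP; left; apply/eqP/eq_bigl => j.
by case: ltnP => //= ij; rewrite -val_eqE /= gtn_eqF.
Qed.

Lemma beta_tilde_le_bar i : beta_tilde B i <= beta_bar B i.
Proof.
by rewrite lerB // ler_sum // => j _; rewrite ler_piMr // lmax_le1.
Qed.

Lemma beta_bar_gt0 i : 0 < beta_bar B i.
Proof. exact: lt_le_trans (beta_tilde_gt0 i) (beta_tilde_le_bar i). Qed.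

Lemma diag_div_beta_bar_le i :
  B i i / beta_bar B i
    <= 1 + (beta_bar B i)^-1 * \sum_(k < n | (i < k)%N) `|B i k|.
Proof.
have b_gt0 := beta_bar_gt0 i.
(* Clearing the denominator and moving the sum to the left leaves
   [beta_tilde B i <= beta_bar B i]. *)
rewrite ler_pdivrMr // mulrDl mul1r mulrAC mulVf ?gt_eqF // mul1r -lerBlDr.
exact: beta_tilde_le_bar.
Qed.

Lemma le_diag_div_beta_tilde i :
  1 + (beta_bar B i)^-1 * \sum_(k < n | (i < k)%N) `|B i k|
    <= B i i / beta_tilde B i.
Proof.
have b_gt0 := beta_bar_gt0 i; have t_gt0 := beta_tilde_gt0 i.
have -> : B i i = beta_tilde B i + \sum_(k < n | (i < k)%N) `|B i k|.
  by rewrite subrK.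
rewrite mulrDl divff ?gt_eqF // lerD2l mulrC ler_wpM2l ?sumr_ge0 //.
by rewrite lef_pV2 // beta_tilde_le_bar.
Qed.

End PositiveDiagonallyDominant.

Theorem theorem8 (R : realType) (n : nat) (M B C : 'M[R]_n)
    (hM : B_matrix M) (hB : B = Bplus M) (hC : M = B + C) :
  \sum_(i < n) ((n%:R - 1) / Num.min (beta_bar B i) 1 *
      \prod_(j < n | (j < i)%N) (B j j / beta_bar B j))
    <= \sum_(i < n) ((n%:R - 1) / Num.min (beta_bar B i) 1 *
      \prod_(j < n | (j < i)%N)
        (1 + (beta_bar B j)^-1 * \sum_(k < n | (j < k)%N) `|B j k|)) /\
  \sum_(i < n) ((n%:R - 1) / Num.min (beta_bar B i) 1 *
      \prod_(j < n | (j < i)%N)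
        (1 + (beta_bar B j)^-1 * \sum_(k < n | (j < k)%N) `|B j k|))
    <= \sum_(i < n) ((n%:R - 1) / Num.min (beta_tilde B i) 1 *
      \prod_(j < n | (j < i)%N) (B j j / beta_tilde B j)).
Proof.
have domB : pos_diag_dominant B by rewrite hB; apply: B_matrix_Bplus_dominant.
have bar_gt0 := beta_bar_gt0 domB; have tilde_gt0 := beta_tilde_gt0 domB.
have min_gt0 (x : R) : 0 < x -> 0 < Num.min x 1 by rewrite lt_min ltr01 andbT.
(* The index [i] witnesses n >= 1; for n = 0 the coefficient would be -1, but all the outer sums are
   empty. *)
have n1_ge0 (i : 'I_n) : 0 <= n%:R - 1 :> R.
  by rewrite subr_ge0 ler1n (leq_ltn_trans _ (ltn_ord i)).
have coef_ge0 (x : R) (i : 'I_n) : 0 < x -> 0 <= (n%:R - 1) / Num.min x 1.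
  by move=> /min_gt0/ltW; apply: divr_ge0; exact: n1_ge0 i.
have factor_ge0 (j : 'I_n) : 0 <= B j j / beta_bar B j.
  by rewrite divr_ge0 ?ltW ?dominant_diag_gt0.
have mid_ge0 (j : 'I_n) :=
  le_trans (factor_ge0 j) (diag_div_beta_bar_le domB j).
split; apply: ler_sum => i _.
  apply: ler_wpM2l; first exact: coef_ge0.
  by apply: ler_prod => j _; rewrite factor_ge0 diag_div_beta_bar_le.
(* Unlike in the first inequality, the coefficient changes too: the smaller [beta_tilde] gives a
   smaller minimum, hence a larger quotient. *)
apply: ler_pM; first exact: coef_ge0.
- by apply: prodr_ge0 => j _.
- apply: ler_wpM2l; first exact: n1_ge0 i.
  by rewrite lef_pV2 ?posrE ?min_gt0 // le_min2 ?beta_tilde_le_bar.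
- by apply: ler_prod => j _; rewrite mid_ge0 le_diag_div_beta_tilde.
Qed.
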